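(* Let $X$ be a symmetric space on $[0,1]$ and let $\varDelta=\bigl(\bigoplus_{k=1}^\infty E_k\bigr)_{\ell^1}$ be an $\ell^1$-sum of finite-dimensional Banach spaces, regarded as a Banach sequence space in which the standard unit vectors form a basis. Then no frame in $X$ with respect to $\varDelta$ is projective.
   Context: A symmetric space $X$ on $[0,1]$ is a Banach space of (equivalence classes of) real-valued Lebesgue measurable functions on $[0,1]$ such that: (a) if $y\in X$ and $x$ is measurable with $|x|\le|y|$ a.e., then $x\in X$ and $\|x\|_X\le\|y\|_X$; (b) if $x,y$ are equimeasurable and $y\in X$, then $x\in X$ and $\|x\|_X=\|y\|_X$; normalized so that $\|\chi_{[0,1]}\|_X=1$. Here each $E_k$ is $\mathbb{R}^{d_k}$ with some norm; elements of $\varDelta$ are sequences obtained by concatenating blocks $\xi^{(k)}\in E_k$, with norm $\sum_k\|\xi^{(k)}\|_{E_k}$. For a Banach sequence space $\varDelta$ in which the unit vectors $\delta_n$ form a basis, $\varDelta^*$ is identified with sequences $\eta$ with $\|\eta\|_{\varDelta^*}=\sup_{\|\xi\|_\varDelta\le1}|\sum_n\xi_n\eta_n|$. A sequence $\{x_n\}$ of nonzero elements of a Banach space $X$ is a frame in $X$ with respect to $\varDelta$ if there are $0<A\le B<\infty$ with $A\|y\|_{X^*}\le\|\{\langle x_n,y\rangle\}_n\|_{\varDelta^*}\le B\|y\|_{X^*}$ for all $y\in X^*$. Such a frame is projective if there exist a Banach space $Y$ and a basis $\{e_n\}$ of $X\times Y$ equivalent to the unit vector basis $\{\delta_n\}$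 of $\varDelta$ such that $x_n=Pe_n$ for all $n$, where $P:X\times Y\to X$ is the canonical projection. *)

(* Defs.v *)
From HB Require Import structures.
From mathcomp Require Import all_boot all_order all_algebra.
From mathcomp Require Import all_classical all_reals all_analysis.
Set Implicit Arguments. Unset Strict Implicit. Unset Printing Implicit Defensive.
Import Order.TTheory GRing.Theory Num.Theory.
Import numFieldNormedType.Exports.
Local Open Scope classical_set_scope.
Local Open Scope ring_scope.

Section Defs.
Context {R : realType}.

Definition I01 : set R := `[0%R, 1%R].
Definition lebR : set R -> \bar R := @lebesgue_measure R.

Definition ae01 (P : R -> Prop) : Prop :=
  exists Nu : set R,
    [/\ measurable Nu, lebR Nu = 0%E & forall t, I01 t -> ~ Nu t -> P t].

Definition equimeasurable (x y : R -> R) : Prop :=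
  forall s : R, lebR (I01 `&` [set t | s < x t]) = lebR (I01 `&` [set t | s < y t]).

(** A symmetric space on [0,1]: the set S of (representatives of) its elements,
    together with the norm nX, which only depends on the a.e.-class. *)
Record symmetric_space (S : set (R -> R)) (nX : (R -> R) -> R) : Prop := {
  ss_meas : forall f, S f -> measurable_fun I01 f;
  ss_zero : S (fun _ => 0);
  ss_add : forall f g, S f -> S g -> S (f \+ g);
  ss_scale : forall (a : R) f, S f -> S (fun t => a * f t);
  ss_ge0 : forall f, S f -> 0 <= nX f;
  ss_triangle : forall f g, S f -> S g -> nX (f \+ g) <= nX f + nX g;
  ss_homog : forall (a : R) f, S f -> nX (fun t => a * f t) = `|a| * nX f;
  ss_definite : forall f, S f -> nX f = 0 -> ae01 (fun t => f t = 0);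
  ss_complete : forall u : nat -> R -> R, (forall n, S (u n)) ->
     (forall e : R, 0 < e -> exists M, forall m n, (M <= m)%N -> (M <= n)%N ->
        nX (u m \- u n) < e) ->
     exists f, S f /\ (fun n => nX (u n \- f)) @ \oo --> (0 : R);
  ss_ideal : forall x y : R -> R, S y -> measurable_fun I01 x ->
     ae01 (fun t => `|x t| <= `|y t|) -> S x /\ nX x <= nX y;
  ss_symmetric : forall x y : R -> R, S y -> measurable_fun I01 x ->
     equimeasurable x y -> S x /\ nX x = nX y;
  ss_normalized : S (fun _ => 1) /\ nX (fun _ => 1) = 1 }.

Definition is_dual (S : set (R -> R)) (nX : (R -> R) -> R) (y : (R -> R) -> R) : Prop :=
  (forall f g, S f -> S g -> y (f \+ g) = y f + y g) /\
  (forall (a : R) f, S f -> y (fun t => a * f t) = a * y f) /\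
  (exists C : R, forall f, S f -> `|y f| <= C * nX f).

Definition dual_norm (S : set (R -> R)) (nX : (R -> R) -> R) (y : (R -> R) -> R) : \bar R :=
  ereal_sup [set (`|y f|)%:E | f in [set f | S f /\ nX f <= 1]].

Definition is_norm (m : nat) (n : 'rV[R]_m -> R) : Prop :=
  [/\ forall v, 0 <= n v, forall v, n v = 0 -> v = 0,
      forall (a : R) v, n (a *: v) = `|a| * n v
    & forall u v, n (u + v) <= n u + n v].

(** The l1-sum Delta of E_k = (R^(d k), Nk k): block k of a sequence occupies
    positions Dstart d k, ..., Dstart d k + d k - 1. *)
Definition Dstart (d : nat -> nat) (k : nat) : nat := (\sum_(j < k) d j)%N.

Definition block (d : nat -> nat) (k : nat) (xi : nat -> R) : 'rV[R]_(d k) :=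
  \row_(i < d k) xi (Dstart d k + i)%N.

Definition delta_norm (d : nat -> nat) (Nk : forall k, 'rV[R]_(d k) -> R)
  (xi : nat -> R) : \bar R :=
  (\sum_(0 <= k <oo) (Nk k (block d k xi))%:E)%E.

(** Norm in Delta^* of a sequence eta (sup over finitely supported xi, which
    are dense in Delta since the unit vectors form a basis). *)
Definition delta_dual_norm (d : nat -> nat) (Nk : forall k, 'rV[R]_(d k) -> R)
  (eta : nat -> R) : \bar R :=
  ereal_sup [set r | exists (xi : nat -> R) (M : nat),
     [/\ forall n, (M <= n)%N -> xi n = 0,
         (delta_norm Nk xi <= 1)%E
       & r = (`|\sum_(n < M) xi n * eta n|)%:E]].

Definition is_frame (S : set (R -> R)) (nX : (R -> R) -> R)
  (d : nat -> nat) (Nk : forall k, 'rV[R]_(d k) -> R) (x : nat -> R -> R) : Prop :=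
  (forall n, S (x n) /\ nX (x n) <> 0) /\
  exists A B : R, [/\ 0 < A, A <= B &
    forall y, is_dual S nX y ->
      (A%:E * dual_norm S nX y <= delta_dual_norm Nk (fun n => y (x n)))%E /\
      (delta_dual_norm Nk (fun n => y (x n)) <= B%:E * dual_norm S nX y)%E].

Definition psum1 (Y : Type) (e : nat -> (R -> R) * Y) (a : nat -> R) (M : nat) : R -> R :=
  fun t => \sum_(n < M) a n * (e n).1 t.

Definition psum2 (Y : normedModType R) (e : nat -> (R -> R) * Y) (a : nat -> R) (M : nat) : Y :=
  \sum_(n < M) a n *: (e n).2.

Definition series_to (nX : (R -> R) -> R) (Y : normedModType R)
  (e : nat -> (R -> R) * Y) (a : nat -> R) (z : (R -> R) * Y) : Prop :=
  (fun M => nX (psum1 e a M \- z.1) + `|psum2 e a M - z.2|) @ \oo --> (0 : R).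

Definition is_basis (S : set (R -> R)) (nX : (R -> R) -> R) (Y : normedModType R)
  (e : nat -> (R -> R) * Y) : Prop :=
  (forall n, S (e n).1) /\
  forall z : (R -> R) * Y, S z.1 ->
    (exists a, series_to nX e a z) /\
    (forall a b, series_to nX e a z -> series_to nX e b z -> a = b).

Definition equiv_to_delta (nX : (R -> R) -> R) (Y : normedModType R)
  (e : nat -> (R -> R) * Y)
  (d : nat -> nat) (Nk : forall k, 'rV[R]_(d k) -> R) : Prop :=
  exists c C : R, [/\ 0 < c, 0 < C &
    forall (a : nat -> R) (M : nat), (forall n, (M <= n)%N -> a n = 0) ->
      (c%:E * delta_norm Nk a <= (nX (psum1 e a M) + `|psum2 e a M|)%:E)%E /\
      ((nX (psum1 e a M) + `|psum2 e a M|)%:E <= C%:E * delta_norm Nk a)%E].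

Definition is_projective (S : set (R -> R)) (nX : (R -> R) -> R)
  (d : nat -> nat) (Nk : forall k, 'rV[R]_(d k) -> R) (x : nat -> R -> R) : Prop :=
  exists (Y : completeNormedModType R) (e : nat -> (R -> R) * Y),
    [/\ is_basis S nX e, equiv_to_delta nX e Nk
      & forall n, ae01 (fun t => x n t = (e n).1 t)].

End Defs.

(* Main.v *)
(** A basis of X x Y equivalent to the unit vectors of Delta embeds X into the
    l1-sum, via the expansion coefficients of (f, 0).  Call a sequence in X flat
    if its N-term averages, with arbitrary signs, tend to zero in norm uniformly.
    Every coordinate functional tends to zero along a flat sequence, so if the
    sequence is bounded below, a gliding hump in the l1-sum shows that sums of N
    suitable terms have norm at least a multiple of N, contradicting flatness.
    But every symmetric space contains a flat sequence bounded below: the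
    Rademacher functions if the norm of the indicator of [0, t[ tends to 0 with
    t, and otherwise the indicators of disjoint intervals. *)
Require Import Defs.
From HB Require Import structures.
From mathcomp Require Import all_boot all_order all_algebra.
From mathcomp Require Import all_classical all_reals all_analysis.
From mathcomp Require Import measurable_realfun ring lra.
Set Implicit Arguments. Unset Strict Implicit. Unset Printing Implicit Defensive.
Import Order.TTheory GRing.Theory Num.Theory.
Import numFieldNormedType.Exports.
Local Open Scope classical_set_scope.
Local Open Scope ring_scope.

(** * Norms on R^m against the coordinates *)

Section FiniteDimensionalNorms.
Context {R : realType} (m : nat) (n : 'rV[R]_m -> R).
Hypothesis nP : is_norm n.

Lemma is_norm0 : n 0 = 0.
Proof. by have [_ _ nZ _] := nP; rewrite -(scale0r 0) nZ normr0 mul0r. Qed.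

Lemma is_normN v : n (- v) = n v.
Proof. by have [_ _ nZ _] := nP; rewrite -scaleN1r nZ normrN1 mul1r. Qed.

Lemma is_norm_ge_dist u v : n u - n v <= n (u + v).
Proof.
have [_ _ _ nD] := nP; rewrite lerBlDr -{1}(addrK v u).
by rewrite (le_trans (nD _ _))// is_normN.
Qed.

Lemma is_norm_sum (I : Type) (r : seq I) (F : I -> 'rV[R]_m) :
  n (\sum_(i <- r) F i) <= \sum_(i <- r) n (F i).
Proof.
have [_ _ _ nD] := nP.
elim/big_ind2: _ => [|a b c e ab ce|//]; first by rewrite is_norm0.
by rewrite (le_trans (nD _ _))// lerD.
Qed.

Lemma mx_entry_le_norm (v : 'rV[R]_m) i : `|v 0 i| <= `|v|.
Proof.
rewrite [leRHS]/Num.norm /= mx_normrE; apply/bigmax_geP; right => /=.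
by exists (0, i).
Qed.

Lemma is_norm_le_coord v : n v <= \sum_i `|v 0 i| * n (delta_mx 0 i).
Proof.
have [_ _ nZ _] := nP.
rewrite {1}(row_sum_delta v) (le_trans (is_norm_sum _ _))//.
by apply: ler_sum => i _; rewrite nZ.
Qed.

(** By the reverse triangle inequality [n] is Lipschitz for the sup norm, the constant being the sum
    of its values at the unit vectors. *)
Lemma is_norm_continuous : continuous n.
Proof.
have [n0 _ _ _] := nP.
pose K := \sum_i n (delta_mx 0 i).
have nK v : n v <= `|v| * K.
  rewrite (le_trans (is_norm_le_coord v))// mulr_sumr ler_sum// => i _.
  by rewrite ler_wpM2r// mx_entry_le_norm.
have K0 : 0 <= K by apply: sumr_ge0.
move=> v; apply/(@cvgrPdist_lt _ _ _ _ (nbhs_filter v)) => e e0.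
(* [K] is 0 when m = 0, so the division is by [K + 1]. *)
have d0 : 0 < e / (K + 1) by rewrite divr_gt0// ltr_wpDl.
apply: filterS (nbhsx_ballx v _ d0) => w.
rewrite mx_norm_ball /ball_ /= ltr_pdivlMr ?ltr_wpDl// => h.
apply: le_lt_trans h; apply: (@le_trans _ _ (`|v - w| * K)); last first.
  by rewrite ler_wpM2l// lerDl.
have h1 := is_norm_ge_dist v (- w); have h2 := is_norm_ge_dist w (- v).
rewrite is_normN in h1; rewrite is_normN -(opprB v w) is_normN in h2.
have := nK (v - w).
rewrite ler_norml => h3; apply/andP; split; lra.
Qed.

(* n attains a positive minimum on the unit sphere of the sup norm. *)
Lemma is_norm_coord_bound :
  exists2 C : R, 0 < C & forall (v : 'rV[R]_m) i, `|v 0 i| <= C * n v.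
Proof.
have [n0 nd nZ _] := nP.
(* For m = 0 the unit sphere is empty and offers no minimum, but then there is no coordinate to
   bound. *)
have [m0 | [i0 _]] : (m = 0%N) \/ (exists i : 'I_m, True).
- by move: (m) => -[|k]; [left | right; exists ord0].
- by exists 1 => // v i; have := ltn_ord i; rewrite [X in (_ < X)%N]m0.
pose A : set 'rV[R]_m := [set v | `|v| = 1].
have A0 : A !=set0.
  have d0 : (delta_mx 0 i0 : 'rV[R]_m) != 0.
    apply/eqP => /matrixP/(_ 0 i0); rewrite !mxE !eqxx /=.
    by move/eqP; rewrite oner_eq0.
  exists (`|(delta_mx 0 i0 : 'rV[R]_m)|^-1 *: delta_mx 0 i0).
  by rewrite /A /= normrZ normfV normr_id mulVf// normr_eq0.
have cA : compact A.
  apply: bounded_closed_compact.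
    exists 1; split; first exact: num_real.
    by move=> x x1 v /= ->; apply: ltW.
  have -> : A = (fun v : 'rV[R]_m => `|v|) @^-1` [set 1] by [].
  apply: preimage_closed; last exact: closed_eq.
  by move=> v _; apply: norm_continuous.
have [c cA1 cmin] := EVT_min_rV A0 cA (continuous_subspaceT is_norm_continuous).
move: cA1; rewrite inE => c1.
have nc : 0 < n c.
  rewrite lt_neqAle n0 andbT eq_sym; apply/eqP => /nd c0.
  by move: c1; rewrite /A /= c0 normr0 => /eqP; rewrite eq_sym oner_eq0.
exists (n c)^-1; first by rewrite invr_gt0.
move=> v i; rewrite (le_trans (mx_entry_le_norm v i))// mulrC ler_pdivlMr//.
have [->|v0] := eqVneq v 0; first by rewrite normr0 mul0r.
have /cmin : `|v|^-1 *: v \in A.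
  by rewrite inE /A /= normrZ normfV normr_id mulVf// normr_eq0.
by rewrite nZ normfV normr_id mulrC ler_pdivlMr ?normr_gt0// mulrC.
Qed.

End FiniteDimensionalNorms.

(** * Partial sums of the norm of the l1-sum *)

Section HeadNorms.
Context {R : realType} (d : nat -> nat) (Nk : forall k, 'rV[R]_(d k) -> R).
Arguments Nk : clear implicits.
Hypothesis NkP : forall k, is_norm (Nk k).
Implicit Types (a b : nat -> R) (k K L M : nat).

(** Being real-valued, these partial sums of [delta_norm] apply to a coefficient sequence before its
    full norm is known to be finite. *)
Definition head_norm (K : nat) (a : nat -> R) : R :=
  \sum_(k < K) Nk k (block d k a).

Definition trunc (M : nat) (a : nat -> R) : nat -> R :=
  fun n => if (n < M)%N then a n else 0.

Lemma Dstart_le K L : (K <= L)%N -> (Dstart d K <= Dstart d L)%N.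
Proof.
move=> KL; rewrite /Dstart -(subnKC KL) big_split_ord /=.
by rewrite leq_addr.
Qed.

Lemma DstartS K : Dstart d K.+1 = (Dstart d K + d K)%N.
Proof. by rewrite /Dstart big_ord_recr. Qed.

(** Blocks may be empty, and it takes infinitely many nonempty ones to reach every index. *)
Lemma Dstart_unbounded : (forall K, exists k, (K <= k)%N /\ (0 < d k)%N) ->
  forall n, exists K, (n <= Dstart d K)%N.
Proof.
move=> dP; elim=> [|n [K nK]]; first by exists 0%N.
have [k [Kk dk]] := dP K; exists k.+1.
rewrite DstartS -addn1 leq_add// (leq_trans nK)//.
exact: Dstart_le.
Qed.

Lemma head_norm_le K L a : (K <= L)%N -> head_norm K a <= head_norm L a.
Proof.
move=> KL; rewrite /head_norm -(subnKC KL) big_split_ord /= lerDl.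
by apply: sumr_ge0 => i _; have [] := NkP (K + i).
Qed.

Lemma block_comb k a b (s : R) :
  block d k (fun n => s * a n + b n) = s *: block d k a + block d k b.
Proof. by apply/rowP => i; rewrite !mxE. Qed.

(* The increments of head_norm are themselves seminorms, so the reverse
   triangle inequality may be used differently before and after block K. *)
Lemma head_norm_addl_ge K L a b (s : R) : `|s| = 1 -> (K <= L)%N ->
  head_norm K b - head_norm K a
    + (head_norm L a - head_norm K a) - (head_norm L b - head_norm K b)
  <= head_norm L (fun n => s * a n + b n).
Proof.
have nsa k v : `|s| = 1 -> Nk k (s *: v) = Nk k v.
  by have [_ _ -> _] := NkP k => ->; rewrite mul1r.
move=> s1 KL; rewrite /head_norm -(subnKC KL) !big_split_ord /=.
have lo : \sum_(k < K) Nk k (block d k b) - \sum_(k < K) Nk k (block d k a)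
    <= \sum_(k < K) Nk k (block d k (fun n => s * a n + b n)).
  rewrite -sumrB ler_sum// => i _; rewrite block_comb [X in _ <= Nk _ X]addrC.
  by rewrite -(nsa _ (block d i a) s1); exact: is_norm_ge_dist (NkP _) _ _.
have hi : \sum_(i < L - K) Nk (K + i)%N (block d (K + i) a)
      - \sum_(i < L - K) Nk (K + i)%N (block d (K + i) b)
    <= \sum_(i < L - K) Nk (K + i)%N (block d (K + i) (fun n => s * a n + b n)).
  rewrite -sumrB ler_sum// => i _; rewrite block_comb.
  by rewrite -(nsa _ (block d (K + i) a) s1); exact: is_norm_ge_dist (NkP _) _ _.
lra.
Qed.

(** A cut at a block boundary leaves the first K blocks intact and annihilates all later ones. *)
Lemma delta_norm_trunc K a :
  delta_norm Nk (trunc (Dstart d K) a) = (head_norm K a)%:E.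
Proof.
rewrite /delta_norm (@nneseries_split _ _ 0 K); last first.
  by move=> k _; rewrite lee_fin; have [] := NkP k.
rewrite add0n eseries0 ?adde0; last first.
  move=> k Kk _; have -> : block d k (trunc (Dstart d K) a) = 0.
    apply/rowP => i; rewrite !mxE /trunc ltnNge.
    by rewrite (leq_trans (Dstart_le Kk)) ?leq_addr.
  by rewrite is_norm0.
rewrite big_mkord sumEFin; congr (_%:E); apply: eq_bigr => k _.
congr (Nk _ _); apply/rowP => i; rewrite !mxE /trunc.
have -> // : (Dstart d k + i < Dstart d K)%N.
by rewrite (leq_trans _ (Dstart_le (ltn_ord k)))// DstartS ltn_add2l.
Qed.

Lemma Dstart_block n K : (n < Dstart d K)%N ->
  exists (k : 'I_K) (i : 'I_(d k)), n = (Dstart d k + i)%N.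
Proof.
elim: K => [|K IH]; first by rewrite /Dstart big_ord0.
rewrite DstartS => nK; have [/IH[k [i ->]]|Kn] := ltnP n (Dstart d K).
  by exists (widen_ord (leqnSn K) k), i.
have iK : (n - Dstart d K < d K)%N by rewrite ltn_subLR.
by exists ord_max, (Ordinal iK); rewrite /= subnKC.
Qed.

Lemma head_norm_coord_bound n K : (n < Dstart d K)%N ->
  exists2 C : R, 0 < C & forall a, `|a n| <= C * head_norm K a.
Proof.
move=> /Dstart_block[k [i ->]].
have [C C0 CP] := is_norm_coord_bound (NkP k).
exists C => // a; have := CP (block d k a) i; rewrite mxE => h.
rewrite (le_trans h)// ler_wpM2l ?(ltW C0)// /head_norm (bigD1 k)//= lerDl.
by apply: sumr_ge0 => j _; have [] := NkP j.
Qed.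

Lemma head_norm_coord_le K : exists2 C : R, 0 < C &
  forall a (e : R), 0 <= e -> (forall n, (n < Dstart d K)%N -> `|a n| <= e) ->
    head_norm K a <= C * e.
Proof.
pose C := \sum_(k < K) \sum_i Nk k (delta_mx 0 i).
have C0 : 0 <= C.
  by apply: sumr_ge0 => k _; apply: sumr_ge0 => i _; have [] := NkP k.
(* [C] vanishes when the first K blocks are all empty; adding 1 keeps the constant positive. *)
exists (1 + C); first by rewrite ltr_pwDl.
move=> a e e0 ae; apply: (@le_trans _ _ (C * e)); last first.
  by rewrite ler_wpM2r// lerDr.
rewrite mulr_suml ler_sum// => k _.
rewrite (le_trans (is_norm_le_coord (NkP k) _))// mulr_suml ler_sum// => i _.
rewrite mulrC ler_wpM2l//; first by have [] := NkP k.
rewrite mxE ae// (leq_trans _ (Dstart_le (ltn_ord k)))//.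
by rewrite DstartS ltn_add2l.
Qed.

End HeadNorms.

(** * Flat sequences and vector operations in a symmetric space *)

Lemma notin_gt_bigmax (J : seq nat) k : (\max_(j <- J) j < k)%N -> k \notin J.
Proof.
by apply: contraL => kJ; rewrite -leqNgt (big_rem k)//= leq_maxl.
Qed.

Lemma infinitely_many_seq (P : nat -> Prop) :
  (forall K, exists2 k, (K <= k)%N & P k) ->
  forall N, exists J : seq nat, [/\ uniq J, size J = N & forall j, j \in J -> P j].
Proof.
move=> inf; elim=> [|N [J [uJ sJ PJ]]]; first by exists [::].
have [k /notin_gt_bigmax kJ Pk] := inf (\max_(j <- J) j).+1.
exists (k :: J); split => /=; [by rewrite kJ|by rewrite sJ|].
by move=> j; rewrite inE => /predU1P[->//|/PJ].
Qed.

(** [N] depends on [eps] alone, so the terms and the multipliers may be chosen after it. Multipliers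
    fill [-1, 1], which admits [Num.sg] with its value 0. *)
Definition flat (R : realType) (nX : (R -> R) -> R) (g : nat -> R -> R) : Prop :=
  forall eps : R, 0 < eps ->
  exists2 N, (0 < N)%N & forall (J : seq nat) (s : nat -> R),
    uniq J -> size J = N -> (forall j, `|s j| <= 1) ->
    nX (fun t => \sum_(j <- J) s j * g j t) <= eps * N%:R.

Section SymmetricSpaceNorm.
Context {R : realType} (S : set (R -> R)) (nX : (R -> R) -> R).
Hypothesis SP : symmetric_space S nX.

Lemma ss_sum (r : seq nat) (c : nat -> R) (g : nat -> R -> R) :
  (forall n, S (g n)) -> S (fun t => \sum_(j <- r) c j * g j t).
Proof.
move=> Sg; elim: r => [|j r IH].
  by under eq_fun do rewrite big_nil; exact: ss_zero SP.
under eq_fun do rewrite big_cons.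
exact: (ss_add SP (ss_scale SP (c j) (Sg j)) IH).
Qed.

Lemma ss_sub f g : S f -> S g -> S (f \- g).
Proof.
move=> Sf Sg; have -> : f \- g = f \+ (fun t => -1 * g t).
  by apply/funext => t /=; rewrite mulN1r.
exact: (ss_add SP Sf (ss_scale SP _ Sg)).
Qed.

Lemma ss_norm_distC f g : S f -> S g -> nX (f \- g) = nX (g \- f).
Proof.
move=> Sf Sg; have -> : f \- g = (fun t => -1 * (g \- f) t).
  by apply/funext => t /=; rewrite mulN1r opprB.
by rewrite (ss_homog SP) ?normrN1 ?mul1r//; exact: ss_sub.
Qed.

Lemma ss_norm_le_dist f g : S f -> S g -> nX f <= nX g + nX (f \- g).
Proof.
move=> Sf Sg; have {1}-> : f = g \+ (f \- g).
  by apply/funext => t /=; rewrite addrC subrK.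
exact: (ss_triangle SP Sg (ss_sub Sf Sg)).
Qed.

End SymmetricSpaceNorm.

(** * Expansion coefficients and the gliding hump *)

Section Expansions.
Context {R : realType} (S : set (R -> R)) (nX : (R -> R) -> R).
Hypothesis SP : symmetric_space S nX.
Context (d : nat -> nat) (Nk : forall k, 'rV[R]_(d k) -> R).
Arguments Nk : clear implicits.
Hypothesis NkP : forall k, is_norm (Nk k).
Hypothesis dP : forall K, exists k, (K <= k)%N /\ (0 < d k)%N.
Context (Y : completeNormedModType R) (e : nat -> (R -> R) * Y).
Hypothesis eS : forall n, S (e n).1.

(** X is embedded through the vectors (f, 0): the Y-components of the partial sums tend to zero, so
    only the norm of [f] survives in the limit. *)
Definition expands (f : R -> R) (a : nat -> R) : Prop :=
  S f /\ series_to nX e a (f, 0).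

Lemma psum1_in a M : S (psum1 e a M).
Proof.
rewrite /psum1; under eq_fun do rewrite -(big_mkord xpredT (fun n => a n * (e n).1 _)).
exact: (ss_sum SP).
Qed.

Lemma expands0 : expands (fun=> 0) (fun=> 0).
Proof.
split; first exact: ss_zero SP.
rewrite /series_to [X in X @ _ --> _](_ : _ = cst 0); first exact: cvg_cst.
apply/funext => M /=.
have -> : psum1 e (fun=> 0) M \- (fun=> 0) = (fun t => 0 * (0:R)).
  by apply/funext => t /=; rewrite /psum1 subr0 mul0r big1// => i _; rewrite mul0r.
rewrite (ss_homog SP)//; last exact: ss_zero SP.
rewrite /psum2 subr0 big1 ?normr0 ?mul0r ?addr0// => i _.
by rewrite scale0r.
Qed.

Lemma expands_comb (s : R) f a g b : expands f a -> expands g b ->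
  expands (fun t => s * f t + g t) (fun n => s * a n + b n).
Proof.
move=> [Sf fa] [Sg gb].
have Ssf := ss_scale SP s Sf.
split; first exact: (ss_add SP Ssf Sg).
pose u a f M := nX (psum1 e a M \- f) + `|psum2 e a M - 0|.
(* The error of the combination is squeezed between 0 and this combination of the two errors. *)
have h : (fun M => `|s| * u a f M + u b g M) @ \oo --> (0 : R).
  by rewrite -(addr0 0) -{1}(mulr0 `|s|); apply: cvgD gb; apply: cvgM fa; exact: cvg_cst.
apply: (squeeze_cvgr _ (cvg_cst (0 : R)) h).
apply: nearW => M /=.
rewrite addr_ge0 ?(ss_ge0 SP)//=; last first.
  by apply: (ss_sub SP) (psum1_in _ _) (ss_add SP Ssf Sg).
have Sa := ss_sub SP (psum1_in a M) Sf; have Sb := ss_sub SP (psum1_in b M) Sg.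
rewrite mulrDr addrACA lerD//.
  rewrite -(ss_homog SP)// (le_trans _ (ss_triangle SP (ss_scale SP s Sa) Sb))//.
  rewrite le_eqVlt; apply/orP; left; apply/eqP; congr nX; apply/funext => t /=.
  rewrite /psum1; under eq_bigr do rewrite mulrDl -mulrA.
  by rewrite big_split /= -mulr_sumr; ring.
rewrite !subr0 /psum2 -normrZ (le_trans _ (ler_normD _ _))//.
rewrite le_eqVlt; apply/orP; left; apply/eqP; congr `|_|.
rewrite scaler_sumr -big_split /=; apply: eq_bigr => i _.
by rewrite scalerDl scalerA.
Qed.

Lemma expands_sum (r : seq nat) (c : nat -> R) (g : nat -> R -> R)
    (a : nat -> nat -> R) : (forall j, expands (g j) (a j)) ->
  expands (fun t => \sum_(j <- r) c j * g j t) (fun n => \sum_(j <- r) c j * a j n).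
Proof.
move=> ga; elim: r => [|j r IH].
  under eq_fun do rewrite big_nil; under [X in expands _ X]eq_fun do rewrite big_nil.
  exact: expands0.
under eq_fun do rewrite big_cons; under [X in expands _ X]eq_fun do rewrite big_cons.
exact: expands_comb.
Qed.

(** Partial sums are examined at block boundaries only, where their norm is comparable to a head
    norm. *)
Lemma expands_near f a (eta : R) : expands f a -> 0 < eta ->
  exists K0, forall K, (K0 <= K)%N ->
    nX (psum1 e a (Dstart d K) \- f) + `|psum2 e a (Dstart d K)| < eta.
Proof.
move=> [Sf fa] eta0.
have /cvgrPdist_lt/(_ _ eta0)[M _ MP] := fa.
have [K0 MK0] := Dstart_unbounded dP M.
exists K0 => K KK; have /= := MP _ (leq_trans MK0 (Dstart_le d KK)).
by rewrite sub0r normrN subr0; apply: le_lt_trans; exact: ler_norm.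
Qed.

Context (c C : R).
Hypotheses (c0 : 0 < c) (C0 : 0 < C).
Hypothesis ecC : forall (a : nat -> R) (M : nat),
  (forall n, (M <= n)%N -> a n = 0) ->
  (c%:E * delta_norm Nk a <= (nX (psum1 e a M) + `|psum2 e a M|)%:E)%E /\
  ((nX (psum1 e a M) + `|psum2 e a M|)%:E <= C%:E * delta_norm Nk a)%E.

(** The equivalence of bases speaks of finitely supported sequences, so it is applied to the
    truncation of [a], which has the same partial sum. *)
Lemma head_norm_equiv a K :
  c * head_norm Nk K a
    <= nX (psum1 e a (Dstart d K)) + `|psum2 e a (Dstart d K)|
    <= C * head_norm Nk K a.
Proof.
set D := Dstart d K.
have tr n : (D <= n)%N -> trunc D a n = 0 by rewrite /trunc ltnNge => ->.
have := ecC tr; rewrite delta_norm_trunc// -!EFinM !lee_fin.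
have -> : psum1 e (trunc D a) D = psum1 e a D.
  by apply/funext => t; apply: eq_bigr => n _; rewrite /trunc ltn_ord.
have -> : psum2 e (trunc D a) D = psum2 e a D.
  by apply: eq_bigr => n _; rewrite /trunc ltn_ord.
by move=> [-> ->].
Qed.

(** Head norms grow with K, so K may be enlarged until the partial sum is within [eta] of (f, 0).
    The bound is uniform in K: the coefficients lie in the l1-sum. *)
Lemma expands_head_norm_le f a K : expands f a -> c * head_norm Nk K a <= nX f.
Proof.
move=> fa; apply/ler_addgt0Pr => eta eta0.
have [K0 K0P] := expands_near fa eta0.
set L := maxn K0 K.
apply: (@le_trans _ _ (c * head_norm Nk L a)).
  by rewrite ler_pM2l// head_norm_le// leq_maxr.
have /andP[h _] := head_norm_equiv a L; apply: (le_trans h).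
have := K0P L (leq_maxl _ _).
have := ss_norm_le_dist SP (psum1_in a (Dstart d L)) fa.1.
lra.
Qed.

Lemma expands_le_head_norm f a (eta : R) : expands f a -> 0 < eta ->
  exists K, nX f <= C * head_norm Nk K a + eta.
Proof.
move=> fa eta0; have [K K0P] := expands_near fa eta0; exists K.
have := K0P K (leqnn _).
have /andP[_] := head_norm_equiv a K.
have := ss_norm_le_dist SP fa.1 (psum1_in a (Dstart d K)).
rewrite (ss_norm_distC SP fa.1 (psum1_in _ _)).
have : 0 <= `|psum2 e a (Dstart d K)| by [].
lra.
Qed.

(** The head norms are increasing and bounded, so some [K'] comes within [eta] of their supremum. *)
Lemma expands_tail f a (eta : R) K : expands f a -> 0 < eta ->
  exists2 K', (K <= K')%N &
    forall L, head_norm Nk L a <= head_norm Nk K' a + eta.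
Proof.
move=> fa eta0.
pose E := [set head_norm Nk L a | L in setT].
have ubE : ubound E (c^-1 * nX f).
  by move=> _ [L _ <-]; rewrite ler_pdivlMl//; exact: expands_head_norm_le.
have supE : has_sup E by split; [exists (head_norm Nk 0 a), 0%N | exists (c^-1 * nX f)].
have [_ [K1 _ <-] K1P] := sup_adherent eta0 supE.
exists (maxn K K1); first exact: leq_maxl.
move=> L; have : head_norm Nk L a <= sup E.
  by apply: (ub_le_sup supE.2); exists L.
have := head_norm_le NkP a (leq_maxr K K1).
lra.
Qed.

(** The n-th coefficient is controlled by the norm. If it exceeded [eps] for infinitely many terms,
    then N of them, multiplied by the signs of their coefficients, would add up to a coefficient of
    at least N [eps], too large for a flat sequence. *)
Lemma flat_coord_cvg0 g a n (eps : R) : flat nX g ->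
  (forall j, expands (g j) (a j)) -> 0 < eps ->
  exists K, forall k, (K <= k)%N -> `|a k n| <= eps.
Proof.
move=> fg ga eps0; apply: contrapT => /forallNP noK.
have inf K : exists2 k, (K <= k)%N & eps < `|a k n|.
  have /existsNP[k] := noK K; rewrite not_implyE => -[Kk].
  by move=> /negP; rewrite -ltNge; exists k.
have [K nK] := Dstart_unbounded dP n.+1.
have [B B0 BP] := head_norm_coord_bound NkP nK.
(* The sum of N terms will have norm at least c N [eps] / B; flatness is invoked at half that
   rate. *)
have e'0 : 0 < c * B^-1 * (eps / 2) by rewrite !mulr_gt0// ?invr_gt0.
have [N N0 NP] := fg _ e'0.
have [J [uJ sJ PJ]] := infinitely_many_seq inf N.
pose s j := Num.sg (a j n).
have s1 j : `|s j| <= 1 by rewrite /s normr_sg; case: (_ != 0).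
have := NP J s uJ sJ s1.
have fs := expands_sum J s ga.
have h1 := expands_head_norm_le K fs.
have h2 := BP (fun n => \sum_(j <- J) s j * a j n).
have h3 : N%:R * eps <= \sum_(j <- J) s j * a j n.
  rewrite -sJ -sum1_size natr_sum mulr_suml big_seq [leRHS]big_seq.
  apply: ler_sum => j /PJ; rewrite mul1r /s -normrEsg; exact: ltW.
have h4 := ler_norm (\sum_(j <- J) s j * a j n).
have N0' : 0 < N%:R :> R by rewrite ltr0n.
have {h2 h3 h4} : N%:R * eps <= B * head_norm Nk K (fun n => \sum_(j <- J) s j * a j n).
  by rewrite (le_trans h3)// (le_trans h4).
rewrite -ler_pdivrMl// -(ler_pM2l c0) => h5 h0.
have x0 : 0 < c * (B^-1 * (N%:R * eps)) by rewrite !mulr_gt0 ?invr_gt0.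
have E : c * B^-1 * (eps / 2) * N%:R = c * (B^-1 * (N%:R * eps)) / 2.
  by field; rewrite gt_eqF.
lra.
Qed.

Lemma flat_head_cvg0 g a K (eps : R) : flat nX g ->
  (forall j, expands (g j) (a j)) -> 0 < eps ->
  exists K0, forall k, (K0 <= k)%N -> head_norm Nk K (a k) <= eps.
Proof.
move=> fg ga eps0.
have [B B0 BP] := head_norm_coord_le NkP K.
have e0 : 0 < eps / B by rewrite divr_gt0.
(* Finitely many coordinates enter, so one threshold serves them all. *)
have [K0 K0P] : exists K0, forall n k, (n < Dstart d K)%N -> (K0 <= k)%N ->
    `|a k n| <= eps / B.
  elim: (Dstart d K) => [|D [K0 K0P]]; first by exists 0%N.
  have [K1 K1P] := flat_coord_cvg0 D fg ga e0.
  exists (maxn K0 K1) => n k; rewrite ltnS leq_eqVlt geq_max.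
  by move=> /predU1P[->|nD] /andP[k0 k1]; [exact: K1P|exact: K0P].
exists K0 => k Kk.
have := BP (a k) (eps / B) (ltW e0) (fun n nK => K0P n k nK Kk).
by rewrite mulrC divfK// gt_eqF.
Qed.

(* Gliding hump: each new vector is chosen so far out that it is almost
   disjointly supported from the sum of the previous ones. *)
Lemma gliding_hump g a (delta : R) : 0 < delta -> flat nX g ->
  (forall j, expands (g j) (a j)) -> (forall j, delta <= nX (g j)) ->
  forall N, exists (J : seq nat) (L : nat), [/\ uniq J, size J = N &
    N%:R * (delta / (4 * C)) <= head_norm Nk L (fun n => \sum_(j <- J) 1 * a j n)].
Proof.
(* Each step gains [h]. The new vector has head norm at least [delta / (2 * C)], that is 2 h. Three
   errors of h / 3 are lost: the tail of the old sum once, the head of the new vector twice. *)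
move=> delta0 fg ga dg; pose h := delta / (4 * C).
have h0 : 0 < h by rewrite divr_gt0// mulr_gt0.
rewrite -/h.
elim=> [|N [J [L [uJ sJ hJ]]]].
  exists [::], 0%N; split => //.
  by rewrite mul0r /head_norm big_ord0.
have fs := expands_sum J (fun=> 1) ga.
have h3 : 0 < h / 3 by rewrite divr_gt0.
have [K LK KP] := expands_tail L fs h3.
have [K0 K0P] := flat_head_cvg0 K fg ga h3.
(* The second entry of the maximum makes [k] different from all indices in [J]. *)
set k := maxn K0 (\max_(j <- J) j).+1.
have [L1] := expands_le_head_norm (ga k) (eta := delta / 2) ltac:(lra).
have {}K0P := K0P k (leq_maxl _ _).
set b := (fun n => _) in hJ fs KP.
move=> L1P; set M := maxn K L1.
have d2 : 2 * h <= head_norm Nk M (a k).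
  have /(ler_wpM2l (ltW C0)) := head_norm_le NkP (a k) (leq_maxr K L1).
  rewrite -/M => L1M; rewrite -(ler_pM2l C0).
  have -> : C * (2 * h) = delta / 2 by rewrite /h; field; rewrite gt_eqF.
  have := dg k; lra.
exists (k :: J), M; split => /=.
- by rewrite uJ andbT notin_gt_bigmax// leq_maxr.
- by rewrite sJ.
have -> : (fun n => \sum_(j <- k :: J) 1 * a j n) = (fun n => 1 * a k n + b n).
  by apply/funext => n; rewrite big_cons.
have := head_norm_addl_ge NkP (a k) b (normr1 R) (leq_maxl K L1 : (K <= M)%N).
have := KP M; have := head_norm_le NkP b LK.
have -> : N.+1%:R = N%:R + 1 :> R by rewrite natr1.
lra.
Qed.

Lemma not_flat_of_expansions g (delta : R) :
  (forall f, S f -> exists a, series_to nX e a (f, 0)) ->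
  0 < delta -> (forall j, S (g j)) -> (forall j, delta <= nX (g j)) ->
  ~ flat nX g.
Proof.
move=> ex delta0 Sg dg fg.
have /choice[a ga] : forall j, exists a, expands (g j) a.
  by move=> j; have [a ha] := ex _ (Sg j); exists a.
have hd0 : 0 < delta / (4 * C) by rewrite divr_gt0// mulr_gt0.
(* Half the rate that the gliding hump guarantees, so that the two estimates for the same sum
   collide. *)
have e0 : 0 < c * (delta / (4 * C)) / 2 by rewrite divr_gt0// mulr_gt0.
have [N N0 NP] := fg _ e0.
have [J [L [uJ sJ]]] := gliding_hump delta0 fg ga dg N.
have s1 (j : nat) : `|1 : R| <= 1 by rewrite normr1.
have := NP J (fun=> 1) uJ sJ s1.
have := expands_head_norm_le L (expands_sum J (fun=> 1) ga).
set x := nX _; set y := head_norm _ _ _; set h := delta / _ in hd0 *.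
move=> h1 h2; rewrite -(ler_pM2l c0) => h3.
have N0' : 0 < N%:R :> R by rewrite ltr0n.
have := mulr_gt0 c0 (mulr_gt0 N0' hd0).
have E : c * (N%:R * h) = c * h / 2 * N%:R * 2 by field.
rewrite E in h3 *; clear s1.
lra.
Qed.

End Expansions.

(** * Bounded functions and indicators in a symmetric space *)

Section CharacteristicFunctions.
Context {R : realType} (S : set (R -> R)) (nX : (R -> R) -> R).
Hypothesis SP : symmetric_space S nX.
Implicit Types (A E : set R) (f : R -> R).

Lemma measurable_I01 : measurable (@I01 R).
Proof. exact: measurable_itv. Qed.

Lemma lebR_I01_lt (b : R) : 0 <= b <= 1 -> lebR (I01 `&` `[0, b[) = b%:E.
Proof.
move=> /andP[b0 b1]; rewrite (_ : _ `&` _ = `[0, b[%classic).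
  rewrite /lebR lebesgue_measure_itv /= lte_fin; have [//|b0'] := ltP 0 b.
    by rewrite -EFinB subr0.
  by congr (_%:E); apply/eqP; rewrite eq_le b0 b0'.
apply/seteqP; split => [t [] //|t /=]; rewrite /I01 /= !in_itv /= => /andP[t0 tb].
by rewrite t0 tb ltW// (lt_le_trans tb).
Qed.

Lemma indic_superlevel E (s : R) :
  I01 `&` [set t | s < \1_E t] =
  if s < 0 then I01 else if s < 1 then I01 `&` E else set0.
Proof.
apply/seteqP; split => t /=.
  move=> [It]; rewrite indicE; case: ifPn => // s0; case: (boolP (t \in E)).
    by rewrite inE => Et /= ->.
  by move=> _ /=; rewrite (negbTE s0).
case: ifPn => s0 => [It|].
  by split => //; apply: lt_le_trans s0 _; rewrite indicE ler0n.
by case: ifPn => // s1 [It Et]; split => //; rewrite indicE mem_set.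
Qed.

Lemma indic_equimeasurable A E : lebR (I01 `&` A) = lebR (I01 `&` E) ->
  equimeasurable (\1_A) (\1_E).
Proof.
by move=> AE s; rewrite !indic_superlevel; case: ifP => // _; case: ifP.
Qed.

Lemma ae01_all (P : R -> Prop) : (forall t, I01 t -> P t) -> ae01 P.
Proof.
move=> h; exists set0; split; [exact: measurable0|exact: measure0|].
by move=> t It _; exact: h.
Qed.

Lemma ss_bounded f (M : R) : measurable_fun I01 f -> 0 <= M ->
  ae01 (fun t => `|f t| <= M) -> S f /\ nX f <= M.
Proof.
move=> mf M0 fM; have [S1 n1] := ss_normalized SP.
have fM1 : ae01 (fun t => `|f t| <= `|M * 1|).
  by rewrite mulr1 (ger0_norm M0).
have [Sf nf] := ss_ideal SP (ss_scale SP M S1) mf fM1; split=> //.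
by rewrite (le_trans nf)// (ss_homog SP)// n1 mulr1 ger0_norm.
Qed.

Lemma ss_indic E : measurable E -> S (\1_E) /\ nX (\1_E) <= 1.
Proof.
move=> mE; have mE1 : measurable_fun I01 (\1_E : R -> R).
  exact: measurable_indic.
apply: (ss_bounded mE1) => //.
apply: ae01_all => t _; rewrite indicE; case: (_ \in _) => /=.
  by rewrite normr1.
by rewrite normr0.
Qed.

Lemma ss_indic_le A E : measurable A -> measurable E -> I01 `&` A `<=` E ->
  nX (\1_A) <= nX (\1_E).
Proof.
move=> mA mE AE; have [SE _] := ss_indic mE.
have mA1 : measurable_fun I01 (\1_A : R -> R) by exact: measurable_indic.
apply: (ss_ideal SP SE mA1 _).2; apply: ae01_all => t It; rewrite !indicE.
case: (boolP (t \in A)) => /= [|_]; last by rewrite normr0.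
by rewrite inE => At; rewrite mem_set//; exact: AE.
Qed.

(** By symmetry the norm of an indicator depends on the measure alone; as a function of it, this is
    the fundamental function of the space, read off on the intervals [0, b[. *)
Lemma ss_indic_measure A (b : R) : measurable A -> 0 <= b <= 1 ->
  lebR (I01 `&` A) = b%:E -> nX (\1_A) = nX (\1_(`[0, b[%classic)).
Proof.
move=> mA b01 Ab; have [Sb _] := @ss_indic `[0, b[ (measurable_itv _).
have mA1 : measurable_fun I01 (\1_A : R -> R) by exact: measurable_indic.
apply: (ss_symmetric SP Sb mA1 _).2; apply: indic_equimeasurable.
by rewrite Ab lebR_I01_lt.
Qed.

Lemma ss_indic_small A (eta : R) : measurable A -> 0 <= eta <= 1 ->
  (lebR (I01 `&` A) <= eta%:E)%E -> nX (\1_A) <= nX (\1_(`[0, eta[%classic)).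
Proof.
move=> mA /andP[e0 e1] Ae.
have A0 : (0 <= lebR (I01 `&` A))%E by exact: measure_ge0.
have Af : lebR (I01 `&` A) = (fine (lebR (I01 `&` A)))%:E.
  by rewrite fineK// ge0_fin_numE// (le_lt_trans Ae)// ltry.
rewrite Af lee_fin in Ae; rewrite Af lee_fin in A0.
rewrite (ss_indic_measure mA _ Af) ?A0 ?(le_trans Ae)//.
apply: ss_indic_le; [exact: measurable_itv..|].
move=> t [_] /=; rewrite !in_itv /= => /andP[-> /lt_le_trans]; exact.
Qed.

(* At most one term of the sum is nonzero at each point, so its norm is at
   most 1 however many terms there are. *)
Lemma flat_disjoint_indic (A : nat -> set R) :
  (forall n, measurable (A n)) -> (forall t, forall i j, A i t -> A j t -> i = j) ->
  flat nX (fun n => \1_(A n)).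
Proof.
move=> mA dA eps e0.
(* [N] is such that [eps * N.+1] exceeds the uniform bound 1. *)
have [N _ NP] := near_infty_natSinv_lt (PosNum e0).
exists N.+1 => // J s uJ sJ s1.
apply: (@le_trans _ _ 1); last first.
  by rewrite -ler_pdivrMr ?ltr0n// mul1r ltW//; exact: NP (leqnn N).
apply: (ss_bounded _ _ _).2 => //.
  apply: measurable_sum => j.
  by apply: measurable_funM; [exact: measurable_cst|exact: measurable_indic].
apply: ae01_all => t _.
case: (pselect (exists2 i, i \in J & A i t)) => [[i iJ Ait]|nA].
  rewrite (bigD1_seq i)//= big1 ?addr0 => [|j ji].
    by rewrite indicE mem_set// mulr1.
  rewrite indicE memNset ?mulr0// => Ajt; move/eqP: ji; apply.
  exact: dA Ajt Ait.
rewrite big_seq big1 ?normr0// => j jJ.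
by rewrite indicE memNset ?mulr0// => Ajt; apply: nA; exists j.
Qed.

End CharacteristicFunctions.

(** * Rademacher functions and the distribution of their sums *)

Section Rademacher.
Context {R : realType}.
Implicit Types (b : nat -> R) (t : R) (j k m n : nat).

(** For t >= 0, the index k of the cell [k / 2^m, (k + 1) / 2^m[ that contains t. *)
Definition dyadic (m : nat) (t : R) : nat := Num.truncn (2 ^+ m * t).

(** The sign is a binary digit of t. Levels start at [j.+1] because at level 0 the index is constant
    on [0, 1[. *)
Definition rademacher (j : nat) (t : R) : R := (-1) ^+ dyadic j.+1 t.

Lemma natr_half k : k%:R = (odd k)%:R + 2 * (k./2)%:R :> R.
Proof. by rewrite -{1}(odd_double_half k) natrD -mul2n natrM. Qed.

Lemma dyadic_itv m t : 0 <= t -> (dyadic m t)%:R <= 2 ^+ m * t < (dyadic m t).+1%:R.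
Proof. by move=> t0; apply: Num.Theory.truncn_itv; rewrite mulr_ge0// exprn_ge0. Qed.

Lemma dyadic_half m t : 0 <= t -> dyadic m t = (dyadic m.+1 t)./2.
Proof.
move=> t0; apply: Num.Theory.truncn_def.
have := dyadic_itv m.+1 t0; set k := dyadic _ _ => /andP[].
rewrite exprS -mulrA -[k.+1%:R]natr1 -[k./2.+1%:R]natr1 (natr_half k) => h1 h2.
have : ((odd k)%:R : R) <= 1 by case: (odd k).
have : 0 <= ((odd k)%:R : R) by case: (odd k).
by move=> h3 h4; apply/andP; split; lra.
Qed.

(** The parity of k is k - 2 (k./2), and halving the index lowers the level by one; the sign is thus
    an affine combination of two monotone step functions. *)
Lemma measurable_rademacher j : measurable_fun (@I01 R) (rademacher j).
Proof.
have mT m : measurable_fun (@I01 R) (fun t => (dyadic m t)%:R : R).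
  apply: nondecreasing_measurable; first exact: measurable_I01.
  move=> x y xy; rewrite ler_nat; apply: Num.Theory.le_truncn.
  by rewrite ler_pM2l// exprn_gt0.
have mT' : measurable_fun (@I01 R)
    (fun t => 1 - 2 * (dyadic j.+1 t)%:R + 4 * (dyadic j t)%:R : R).
  apply: measurable_funD; first apply: measurable_funB => //.
    by apply: measurable_funM; [exact: measurable_cst|exact: mT].
  by apply: measurable_funM; [exact: measurable_cst|exact: mT].
apply: eq_measurable_fun mT' => t.
rewrite inE /I01 /= in_itv /= => /andP[t0 _].
rewrite (dyadic_half j t0) /rademacher [X in 2 * X]natr_half -signr_odd.
by case: (odd _); rewrite /= ?expr1 ?expr0; ring.
Qed.

Lemma normr_rademacher j t : `|rademacher j t| = 1.
Proof. by rewrite normrX normrN1 expr1n. Qed.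

(** The constant value of the sum of m Rademacher terms on the k-th cell of level m; [k./2] is the
    cell of the previous level around it. *)
Fixpoint rad_sum (b : nat -> R) (m k : nat) : R :=
  if m is m'.+1 then rad_sum b m' k./2 + b m' * (-1) ^+ k else 0.

Lemma rad_sumE b m t : 0 <= t ->
  \sum_(j < m) b j * rademacher j t = rad_sum b m (dyadic m t).
Proof.
move=> t0; elim: m => [|m IH]; first by rewrite big_ord0.
by rewrite big_ord_recr /= IH -dyadic_half.
Qed.

Lemma sum_ord_double n (F : nat -> R) :
  \sum_(k < n.*2) F k = \sum_(k < n) (F k.*2 + F k.*2.+1).
Proof.
elim: n => [|n IH]; first by rewrite !big_ord0.
by rewrite doubleS !big_ord_recr /= IH addrA.
Qed.

(** Orthonormality in discrete form: the two halves of a cell receive opposite signs, so the cross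
    terms cancel. *)
Lemma rad_sum_second_moment b m :
  \sum_(k < 2 ^ m) rad_sum b m k ^+ 2 = 2 ^+ m * \sum_(j < m) b j ^+ 2.
Proof.
elim: m => [|m IH]; first by rewrite !big_ord0 mulr0 big1// => i _; rewrite /= expr0n.
rewrite expnS mul2n (sum_ord_double _ (fun k => rad_sum b m.+1 k ^+ 2)) /=.
rewrite (eq_bigr (fun k : 'I_(2 ^ m) => 2 * rad_sum b m k ^+ 2 + 2 * b m ^+ 2)).
  rewrite big_split /= -mulr_sumr IH big_ord_recr /= sumr_const card_ord.
  by rewrite -[_ *+ (2 ^ m)]mulr_natr natrX [2 ^+ m.+1]exprS; ring.
move=> k _; rewrite uphalf_double doubleK -[(-1) ^+ k.*2.+1]signr_odd.
rewrite -[(-1) ^+ k.*2]signr_odd /= odd_double /=; ring.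
Qed.

(** [E] is a disjoint union of cells of measure 2^-m, and on each of them the squared sum exceeds
    theta^2. The point 1 is excluded since its index 2^m is out of range. *)
Lemma rad_sum_chebyshev b m (theta : R) : 0 < theta ->
  let E := [set t | 0 <= t < 1 /\ theta < `|\sum_(j < m) b j * rademacher j t|] in
  measurable E /\ (lebR (I01 `&` E) <= ((\sum_(j < m) b j ^+ 2) / theta ^+ 2)%:E)%E.
Proof.
move=> th0 E.
have m2 : 0 < 2 ^+ m :> R by rewrite exprn_gt0.
pose cell k : set R := `[k%:R / 2 ^+ m, k.+1%:R / 2 ^+ m[%classic.
pose P (k : 'I_(2 ^ m)) := theta < `|rad_sum b m k|.
have cellP k t : cell k t -> 0 <= t /\ dyadic m t = k.
  rewrite /cell /= in_itv /= => /andP[h1 h2].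
  split; first by rewrite (le_trans _ h1)// divr_ge0// ltW.
  apply: Num.Theory.truncn_def.
  by rewrite -ler_pdivrMl// -ltr_pdivlMl// ![_^-1 * _]mulrC h1 h2.
have EE : E = \big[setU/set0]_(k < 2 ^ m | P k) cell k.
  apply/seteqP; split => t.
    move=> [/andP[t0 t1]]; rewrite rad_sumE// => Pt.
    have /andP[h1 h2] := dyadic_itv m t0.
    have k2 : (dyadic m t < 2 ^ m)%N.
      rewrite -(ltr_nat R) natrX (le_lt_trans h1)//.
      by rewrite -[ltRHS]mulr1 ltr_pM2l.
    rewrite (bigD1 (Ordinal k2))//=; left.
    by rewrite /cell /= in_itv /= ler_pdivrMr// ltr_pdivlMr// ![t * _]mulrC h1 h2.
  move=> Ut; have [k Pk /cellP[t0 tk]] : exists2 k, P k & cell k t.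
    move: Ut; elim/big_ind: _ => //; last by move=> k Pk kt; exists k.
    by move=> A B hA hB [/hA|/hB].
  have t1 : t < 1.
    have /andP[_ h] := dyadic_itv m t0.
    rewrite -(ltr_pM2l m2) mulr1 (lt_le_trans h)// -natrX ler_nat tk.
    exact: ltn_ord.
  by split; [rewrite t0 t1|rewrite rad_sumE// tk].
have mcell k : measurable (cell k) by exact: measurable_itv.
have lcell k : lebR (cell k) = ((2 ^+ m)^-1)%:E.
  rewrite /lebR /cell lebesgue_measure_itv /= lte_fin ltr_pM2r ?invr_gt0//.
  by rewrite ltr_nat ltnSn -EFinB -mulrBl -natr1 addrAC subrr add0r mul1r.
have tcell : trivIset [set: 'I_(2 ^ m)] (fun k : 'I_(2 ^ m) => cell k).
  move=> i j _ _ [t [/cellP[_ ti] /cellP[_ tj]]].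
  by apply: val_inj; rewrite /= -ti.
have mE : measurable E.
  by rewrite EE; apply: bigsetU_measurable.
split=> //.
rewrite (_ : _ `&` _ = E); last first.
  apply/seteqP; split => [t []//|t [/andP[t0 t1] h]]; split; last by rewrite /E /= t0 t1.
  by rewrite /I01 /= in_itv /= t0 ltW.
rewrite EE /lebR measure_bigsetU_ord; [|by move=> i; exact: mcell|exact: tcell].
rewrite (eq_bigr (fun=> ((2 ^+ m)^-1)%:E)); last first.
  by move=> k _; exact: lcell.
rewrite sumEFin lee_fin ler_pdivlMr ?exprn_gt0// mulr_suml.
rewrite -(ler_pM2l m2) -rad_sum_second_moment mulr_sumr.
rewrite [leRHS](bigID P) /=; apply: ler_wpDr.
  by apply: sumr_ge0 => k _; exact: sqr_ge0.
apply: ler_sum => k Pk; rewrite mulrA divff ?gt_eqF// mul1r.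
by rewrite -[leRHS]real_normK ?num_real// lerXn2r ?nnegrE// ltW.
Qed.

Lemma sum_seq_ord (J : seq nat) m (F : nat -> R) : uniq J ->
  (forall j, j \in J -> (j < m)%N) ->
  \sum_(j <- J) F j = \sum_(j < m) if val j \in J then F j else 0.
Proof.
move=> uJ Jm; rewrite -(big_mkord xpredT (fun j => if j \in J then F j else 0)).
rewrite -big_mkcond -big_filter; apply: perm_big; apply: uniq_perm => //.
  by rewrite filter_uniq// iota_uniq.
move=> j; rewrite mem_filter mem_iota subn0 add0n /=.
by case: (boolP (j \in J)) => // /Jm ->.
Qed.

End Rademacher.

(** * A flat sequence bounded below in every symmetric space *)

Section RademacherInSymmetricSpace.
Context {R : realType} (S : set (R -> R)) (nX : (R -> R) -> R).
Hypothesis SP : symmetric_space S nX.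

Lemma rademacher_ss j : S (rademacher j) /\ 1 <= nX (rademacher j).
Proof.
have mr := measurable_rademacher (R := R) j.
have [Sr _] : S (rademacher j) /\ nX (rademacher j) <= 1.
  by apply: (ss_bounded SP mr) => //; apply: ae01_all => t _; rewrite normr_rademacher.
split=> //; have [S1 n1] := ss_normalized SP; rewrite -n1.
apply: (ss_ideal SP Sr _ _).2; first exact: measurable_cst.
by apply: ae01_all => t _; rewrite normr_rademacher normr1.
Qed.

(* By Chebyshev's inequality the averages of Rademacher functions tend to zero
   in measure, hence in norm since they are uniformly bounded. *)
Lemma flat_rademacher :
  (forall eps : R, 0 < eps -> exists2 eta : R, 0 < eta <= 1 &
    nX (\1_(`[0, eta[%classic)) <= eps) ->
  flat nX rademacher.
Proof.
move=> small eps e0.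
have e2 : 0 < eps / 2 by rewrite divr_gt0.
have [eta /andP[eta0 eta1] etaP] := small _ e2.
(* With threshold [eps / 2 * n], Chebyshev bounds the exceptional measure by 1 / ((eps / 2)^2 n),
   which must not exceed [eta]. *)
have d0 : 0 < (eps / 2) ^+ 2 * eta by rewrite mulr_gt0// exprn_gt0.
have [N _ NP] := near_infty_natSinv_lt (PosNum d0).
exists N.+1 => // J s uJ sJ s1.
have {NP} := NP N (leqnn N); set n := N.+1 in sJ *; rewrite /= => nP.
have n0 : 0 < n%:R :> R by rewrite ltr0n.
(* The sum over [J] is padded with zero coefficients to one over an initial segment, as the
   Chebyshev bound requires. *)
pose m := (\max_(j <- J) j).+1.
have Jm j : j \in J -> (j < m)%N.
  by apply: contraLR; rewrite -leqNgt; exact: notin_gt_bigmax.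
pose b j := if j \in J then s j else 0.
have F_E : (fun t => \sum_(j <- J) s j * rademacher j t) =
    (fun t : R => \sum_(j < m) b j * rademacher j t).
  apply/funext => t; rewrite (sum_seq_ord _ uJ Jm); apply: eq_bigr => j _.
  by rewrite /b; case: ifP => //; rewrite mul0r.
have b2 : \sum_(j < m) b j ^+ 2 <= n%:R.
  rewrite (eq_bigr (fun j : 'I_m => if val j \in J then s j ^+ 2 else 0)); last first.
    by move=> j _; rewrite /b; case: ifP => //; rewrite expr0n.
  rewrite -(sum_seq_ord (fun j => s j ^+ 2) uJ Jm) -sJ -sum1_size natr_sum.
  apply: ler_sum => j _; rewrite -[leLHS]real_normK ?num_real//.
  by rewrite expr_le1.
pose theta := eps / 2 * n%:R.
have th0 : 0 < theta by rewrite mulr_gt0.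
have [mE Ele] := rad_sum_chebyshev b m th0; set E := [set t | _] in mE Ele.
have Esmall : nX (\1_E) <= eps / 2.
  apply: le_trans etaP; apply: (ss_indic_small SP mE); first by rewrite ltW.
  apply: (le_trans Ele); rewrite lee_fin ler_pdivrMr ?exprn_gt0//.
  apply: (le_trans b2); rewrite /theta exprMn mulrA [eta * _]mulrC.
  rewrite expr2 mulrA -[leLHS]mul1r ler_pM2r//.
  by rewrite -ler_pdivrMr// mul1r ltW.
have [SE _] := ss_indic SP mE; have [S1 n1] := ss_normalized SP.
(* The sum is dominated by [theta] off [E] and by the trivial bound n on [E]; each part contributes
   at most n eps / 2 to the norm. *)
have Sy1 := ss_scale SP theta S1; have Sy2 := ss_scale SP n%:R SE.
have mF : measurable_fun I01 (fun t : R => \sum_(j <- J) s j * rademacher j t).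
  apply: measurable_sum => j.
  by apply: measurable_funM; [exact: measurable_cst|exact: measurable_rademacher].
have Fle : ae01 (fun t => `|\sum_(j <- J) s j * rademacher j t|
    <= `|((fun=> theta * 1) \+ (fun t => n%:R * \1_E t)) t|).
  (* The null set removes the point 1, which [E] leaves out. *)
  exists [set 1]; split; [exact: measurable_set1|exact: lebesgue_measure_set1|].
  move=> t; rewrite /I01 /= in_itv /= => /andP[t0 t1] /eqP tn1.
  have tl1 : t < 1 by rewrite lt_neqAle tn1.
  rewrite indicE; case: (boolP (t \in E)) => [_|]; last first.
    rewrite notin_setE /E /= => tE; rewrite mulr0 addr0 mulr1 (ger0_norm (ltW th0)).
    rewrite leNgt; apply/negP => ht; apply: tE; rewrite t0 tl1; split => //.
    by move: ht; rewrite -(congr1 (fun f => f t) F_E).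
  rewrite !mulr1 [leRHS]ger0_norm; last by rewrite addr_ge0// ltW.
  apply: (le_trans (ler_norm_sum _ _ _)); apply: ler_wpDl; first exact: ltW.
  rewrite -sJ -sum1_size natr_sum; apply: ler_sum => j _.
  by rewrite normrM normr_rademacher mulr1.
have [_ hF] := ss_ideal SP (ss_add SP Sy1 Sy2) mF Fle.
apply: (le_trans hF); apply: (le_trans (ss_triangle SP Sy1 Sy2)).
rewrite !(ss_homog SP)// n1 (ger0_norm (ltW th0)) normr_nat mulr1 /theta.
have := Esmall; rewrite -(ler_pM2l n0); lra.
Qed.

Lemma symmetric_space_flat_sequence : exists (g : nat -> R -> R) (delta : R),
  [/\ 0 < delta, forall j, S (g j), forall j, delta <= nX (g j) & flat nX g].
Proof.
have [small|/existsNP[eps]] := pselect (forall eps : R, 0 < eps ->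
  exists2 eta : R, 0 < eta <= 1 & nX (\1_(`[0, eta[%classic)) <= eps).
  exists rademacher, 1; split => //; [|..|exact: flat_rademacher].
  - by move=> j; have [] := rademacher_ss j.
  - by move=> j; have [] := rademacher_ss j.
(* Some [eps] now lies below the norm of the indicator of every [0, eta[, hence of every interval of
   positive length in [0, 1], however short. *)
rewrite not_implyE => -[e0 big].
pose A n : set R := `[n.+2%:R^-1, n.+1%:R^-1[%classic.
have mA n : measurable (A n) by exact: measurable_itv.
have A01 n : I01 `&` A n = A n.
  apply/seteqP; split => [t []//|t At]; split => //; move: At.
  rewrite /A /I01 /= !in_itv /= => /andP[h1 h2].
  rewrite (le_trans _ h1)//= ltW// (lt_le_trans h2)// invf_le1 ?ler1n//.
have Alt n : n.+2%:R^-1 < n.+1%:R^-1 :> R by rewrite ltf_pV2 ?posrE// ltr_nat.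
exists (fun n => \1_(A n)), eps; split => //.
- by move=> j; have [] := ss_indic SP (mA j).
- move=> j; pose eta : R := j.+1%:R^-1 - j.+2%:R^-1.
  have eta0 : 0 < eta by rewrite subr_gt0.
  have eta1 : eta <= 1.
    rewrite lerBlDr ler_wpDr// invf_le1// ler1n//.
  rewrite (ss_indic_measure SP (mA j) (b := eta)); last first.
  + rewrite A01 /lebR lebesgue_measure_itv /= lte_fin Alt -EFinB//.
  + by rewrite ltW.
  rewrite leNgt; apply/negP => h; apply: big; exists eta; first by rewrite eta0.
  exact: ltW.
- apply: (flat_disjoint_indic SP mA) => t i j.
  rewrite /A /= !in_itv /= => /andP[i1 i2] /andP[j1 j2].
  have := le_lt_trans i1 j2; have := le_lt_trans j1 i2.
  rewrite !ltf_pV2 ?posrE// !ltr_nat !ltnS => h1 h2.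
  by apply/eqP; rewrite eqn_leq h1 h2.
Qed.

End RademacherInSymmetricSpace.

Theorem theorem5 (R : realType) (S : set (R -> R)) (nX : (R -> R) -> R)
  (d : nat -> nat) (Nk : forall k, 'rV[R]_(d k) -> R) :
  symmetric_space S nX ->
  (forall k, is_norm (Nk k)) ->
  (forall K, exists k, (K <= k)%N /\ (0 < d k)%N) ->
  forall x : nat -> R -> R, is_frame S nX Nk x -> ~ is_projective S nX Nk x.
Proof.
move=> SP NkP dP x _ [Y [e [[eS eB] [c [C [c0 C0 ecC]]] _]]].
have [g [delta [delta0 Sg dg]]] := symmetric_space_flat_sequence SP.
apply: (not_flat_of_expansions SP NkP dP eS c0 C0 ecC _ delta0 Sg dg).
by move=> f Sf; have [] := eB (f, 0) Sf.
Qed.
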